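(* Let $M=[v_1|\cdots|v_n]$ be a nonnegative $2\times n$ real matrix with $\operatorname{rank}(M)=2$. Then $\operatorname{cvar}(M)=2$ if and only if $M$ can be constructed from the $2\times 2$ identity matrix $I_2$.
   Context: Cyclic sign variation: for $v\in\mathbb{R}^n$, $\operatorname{var}(v)$ is the number of sign changes between consecutive entries after deleting zeros; for nonzero $v$ with first nonzero entry $v_k$, $\operatorname{cvar}(v)=\operatorname{var}(v_k,\dots,v_n,v_k)$, and $\operatorname{cvar}(0)=0$. For a $2\times n$ matrix $M=[v_1|\cdots|v_n]$, $\Delta_i=\det[v_i|v_{i+1}]$ (indices mod $n$) and $\operatorname{cvar}(M)=\operatorname{cvar}(\Delta_1,\dots,\Delta_n)$. Column operations on a matrix $[v_1|\cdots|v_n]$: Join: replace adjacent columns $v_i,v_{i+1}$ by $v_i+v_{i+1}$; Double: replace $v_i$ by two adjacent copies $v_i|v_i$; Cyclic shift: $[v_1|\cdots|v_n]\mapsto[v_n|v_1|\cdots|v_{n-1}]$; Re-scale: replace $v_i$ by $a v_i$, $a\ge0$. $M$ can be constructed from $M'$ if $M$ is obtained from $M'$ by a finite sequence of these operations.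
   Formalization: The formal theorem additionally assumes every column v_i of M is nonzero; without this the claim is false, e.g. [e_1|0|e_2] is constructed from I_2 by Double and Re-scale with a=0, yet has cvar 0. *)

(* Defs.v *)
From mathcomp Require Import all_boot all_order all_algebra.
From mathcomp Require Import reals.
From Stdlib Require Import Relation_Operators.
Set Implicit Arguments.
Unset Strict Implicit.
Unset Printing Implicit Defensive.
Import Order.TTheory GRing.Theory Num.Theory.
Local Open Scope ring_scope.

Section SignVariation.
Variable R : realDomainType.

Definition var (v : seq R) : nat :=
  if [seq x <- v | x != 0] is x :: w
  then count id (pairmap (fun y z => Num.sg y != Num.sg z) x w)
  else 0%N.

(* [drop (find _ v) v] is the suffix v_k, ..., v_n starting at the first
   nonzero entry; it is empty exactly when v = 0. *)
Definition cvar (v : seq R) : nat :=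
  if drop (find (fun x => x != 0) v) v is x :: w
  then var (rcons (x :: w) x)
  else 0%N.

Variable n : nat.

(* [ordS] is the cyclic successor on 'I_n. *)
Definition Delta (M : 'M[R]_(2, n)) (i : 'I_n) : R :=
  \det (row_mx (col i M) (col (ordS i) M) : 'M[R]_2).

(* A zero column v_i kills both Delta_(i-1) and Delta_i, so this count says
   nothing about how the neighbours of v_i compare: [e1|0|e2] has value 0 although
   it arises from I_2 by Double and Rescale (a = 0). This is why the theorem
   assumes that the columns of M are nonzero. *)
Definition cvar_mx (M : 'M[R]_(2, n)) : nat :=
  cvar [seq Delta M i | i <- enum 'I_n].

End SignVariation.

Section Construction.
Variable R : realDomainType.

(* The operations change the number of columns, so they act on the sequence of
   columns v_1, ..., v_n. *)
Definition columns (n : nat) (M : 'M[R]_(2, n)) : seq 'cV[R]_2 :=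
  [seq col j M | j <- enum 'I_n].

Inductive column_op : seq 'cV[R]_2 -> seq 'cV[R]_2 -> Prop :=
| Join s1 u v s2 : column_op (s1 ++ u :: v :: s2) (s1 ++ (u + v) :: s2)
| Double s1 u s2 : column_op (s1 ++ u :: s2) (s1 ++ u :: u :: s2)
| CyclicShift s u : column_op (rcons s u) (u :: s)
| Rescale s1 u s2 (a : R) :
    0 <= a -> column_op (s1 ++ u :: s2) (s1 ++ (a *: u) :: s2).

Definition constructible_from (m n : nat)
    (M' : 'M[R]_(2, m)) (M : 'M[R]_(2, n)) : Prop :=
  clos_refl_trans _ column_op (columns M') (columns M).

End Construction.

(* Main.v *)
(* Deleting a column u with neighbours t and v replaces the consecutive wedges
   t^u, u^v by t^v, which by the Pluecker relation is, up to a positive factor,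
   a nonnegative combination of them; inserting between u and v a vector of
   their cone replaces u^v by two nonnegative multiples of it.  Neither move
   increases the number of cyclic sign changes of the wedges, and all column
   operations but the cyclic shift are composed of such moves.  Deletion needs
   u != 0, so sign changes are counted after discarding the zero columns that
   Rescale may create.  As I_2 has two columns, whatever is built from it has
   cvar at most 2; cvar is even, and it is not 0, because nonnegative columns
   turning in the same direction all around the cycle are parallel, which
   contradicts rank 2.

   Conversely, if cvar = 2 and there are at least three columns, the wedges do
   not strictly alternate in sign, so some column lies in the cone of its two
   neighbours: delete it, construct the rest by induction, and insert it back.
   Two columns u, v are inserted between e1 and e2, which are then deleted. *)

Require Import Defs.
From mathcomp Require Import all_boot all_order all_algebra.
From mathcomp Require Import reals.
From mathcomp Require Import ring zify.
From Stdlib Require Import Relation_Operators.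
Set Implicit Arguments.
Unset Strict Implicit.
Unset Printing Implicit Defensive.
Import Order.TTheory GRing.Theory Num.Theory.
Local Open Scope ring_scope.

Section CyclicPairmap.
Variables (T S : Type) (f : T -> T -> S).
Implicit Type s : seq T.

Definition cyclic_pairmap s : seq S :=
  if s is x :: s' then pairmap f x (rcons s' x) else [::].

Lemma size_cyclic_pairmap s : size (cyclic_pairmap s) = size s.
Proof. by case: s => //= x s; rewrite size_pairmap size_rcons. Qed.

Lemma all_cyclic_pairmap (p : pred S) s :
  all p (cyclic_pairmap s) = cycle (fun x y => p (f x y)) s.
Proof.
by case: s => //= x s; elim: (rcons s x) {1 3}x => //= y t IHt z; rewrite IHt.
Qed.

Lemma nth_cyclic_pairmap x0 y0 s i : (i < size s)%N ->
  nth y0 (cyclic_pairmap s) i = f (nth x0 s i) (nth x0 s (i.+1 %% size s)).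
Proof.
case: s => //= x s lt_i; rewrite (nth_pairmap x0) ?size_rcons //.
rewrite -rcons_cons nth_rcons /= lt_i nth_rcons; move: lt_i.
rewrite ltnS leq_eqVlt => /predU1P[->|lt_i].
  by rewrite ltnn eqxx modnn.
by rewrite lt_i modn_small.
Qed.

Lemma cyclic_pairmap_catC s1 s2 :
  cyclic_pairmap (s2 ++ s1) = rot (size s1) (cyclic_pairmap (s1 ++ s2)).
Proof.
case: s1 s2 => [|x s1] [|y s2] //; first by rewrite rot0 cats0.
  by rewrite cats0 -(size_cyclic_pairmap (x :: s1)) rot_size.
rewrite /= !rcons_cat !rcons_cons -!cat_rcons !pairmap_cat !last_rcons.
by rewrite -(rot_size_cat (pairmap f x _)) size_pairmap size_rcons.
Qed.

Lemma cyclic_pairmap_rot n s :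
  cyclic_pairmap (rot n s) = rot n (cyclic_pairmap s).
Proof.
have [le_n|/ltnW le_n] := leqP (size s) n.
  by rewrite !rot_oversize ?size_cyclic_pairmap.
by rewrite {1}/rot cyclic_pairmap_catC cat_take_drop size_takel.
Qed.

End CyclicPairmap.

Lemma cyclic_pairmap_map (T T' S : Type) (f : T' -> T' -> S) (g : T -> T') s :
  cyclic_pairmap f (map g s) = cyclic_pairmap (fun x y => f (g x) (g y)) s.
Proof.
case: s => //= x s; rewrite -map_rcons.
by elim: (rcons s x) {1 3}x => //= y t IHt z; rewrite IHt.
Qed.

Lemma cyclic_pairmap_enum_ord (T S : Type) (f : T -> T -> S) n (g : 'I_n -> T) :
  cyclic_pairmap f [seq g i | i <- enum 'I_n] =
  [seq f (g i) (g (ordS i)) | i <- enum 'I_n].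
Proof.
rewrite cyclic_pairmap_map; case: n g => [|n] g; first by rewrite enum_ord0.
apply: (@eq_from_nth _ (f (g ord0) (g ord0))) => [|i].
  by rewrite size_cyclic_pairmap size_map.
rewrite size_cyclic_pairmap size_enum_ord => lt_i.
rewrite (nth_cyclic_pairmap _ ord0) ?size_enum_ord //.
rewrite (nth_map ord0) ?size_enum_ord //.
congr (f (g _) (g _)); apply/val_inj.
by rewrite /= !nth_enum_ord // ltn_pmod.
Qed.

Section SignAlternation.
Implicit Types (b c : bool) (t : seq bool).

Definition flips b t : nat := count id (pairmap addb b t).

Definition cyclic_flips t : nat := count id (cyclic_pairmap addb t).

Lemma flips_cons b c t : flips b (c :: t) = (b (+) c + flips c t)%N.
Proof. by []. Qed.

Lemma leq_flips_cons b c t : (flips b t <= flips b (c :: t))%N.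
Proof.
by case: t => // d t; rewrite !flips_cons; case: b; case: c; case: d; lia.
Qed.

Lemma flips_rcons b t c :
  flips b (rcons t c) = (flips b t + (last b t (+) c))%N.
Proof. by rewrite /flips -cats1 pairmap_cat count_cat /= addn0. Qed.

Lemma odd_flips b t : odd (flips b t) = b (+) last b t.
Proof.
elim: t b => [|c t IHt] b; first by rewrite addbb.
rewrite /flips /= oddD [odd (count _ _)]IHt oddb.
by rewrite -addbA (addbA c) addbb.
Qed.

Lemma flips_eq0 b t : flips b t = 0%N -> all (pred1 b) t.
Proof.
elim: t b => //= c t IHt b /eqP; rewrite addn_eq0 eqb0 negb_add.
by case/andP=> /eqP-> /eqP/IHt ->; rewrite eqxx.
Qed.

Lemma leq_flips_subseq b c t1 t2 : subseq t1 t2 ->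
  (flips b (rcons t1 c) <= flips b (rcons t2 c))%N.
Proof.
elim: t2 t1 b => [|d t2 IHt] [|d1 t1] b //.
  move=> _; apply: leq_trans (leq_flips_cons b d _) _.
  by rewrite rcons_cons !(flips_cons b) leq_add2l IHt ?sub0seq.
rewrite /=; case: eqP => [->|_] sub_t; rewrite (flips_cons b d).
  by rewrite flips_cons leq_add2l IHt.
apply: leq_trans (leq_flips_cons b d _) _.
by rewrite flips_cons leq_add2l -rcons_cons IHt.
Qed.

Lemma cyclic_flips_cons b t : cyclic_flips (b :: t) = flips b (rcons t b).
Proof. by []. Qed.

Lemma leq_cyclic_flips_cons b t : (cyclic_flips t <= cyclic_flips (b :: t))%N.
Proof.
case: t => // c t.
rewrite !cyclic_flips_cons rcons_cons flips_cons !flips_rcons.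
by case: b; case: c; case: (last _ _); lia.
Qed.

Lemma leq_cyclic_flips_subseq t1 t2 : subseq t1 t2 ->
  (cyclic_flips t1 <= cyclic_flips t2)%N.
Proof.
elim: t2 t1 => [|b t2 IHt] [|b1 t1] //=.
case: eqP => [->|_] sub_t; first exact: leq_flips_subseq.
exact: leq_trans (IHt _ sub_t) (leq_cyclic_flips_cons _ _).
Qed.

Lemma odd_cyclic_flips t : odd (cyclic_flips t) = false.
Proof.
by case: t => // b t; rewrite cyclic_flips_cons odd_flips last_rcons addbb.
Qed.

Lemma cyclic_flips_catC t1 t2 :
  cyclic_flips (t1 ++ t2) = cyclic_flips (t2 ++ t1).
Proof.
rewrite /cyclic_flips cyclic_pairmap_catC.
by apply/permP; rewrite perm_rot.
Qed.

Lemma cyclic_flips_dup t1 b t2 :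
  cyclic_flips (t1 ++ b :: b :: t2) = cyclic_flips (t1 ++ b :: t2).
Proof.
rewrite cyclic_flips_catC [RHS]cyclic_flips_catC.
by rewrite !cyclic_flips_cons flips_cons addbb.
Qed.

Lemma cyclic_flips_eq0 t : cyclic_flips t = 0%N -> exists b, all (pred1 b) t.
Proof.
case: t => [|b t]; first by exists true.
move/flips_eq0; rewrite all_rcons => /andP[_ all_b].
by exists b; rewrite /= eqxx.
Qed.

End SignAlternation.

Section CyclicSignVariation.
Variable R : realDomainType.
Implicit Types (a b x y z : R) (d : seq R).

Definition signs d : seq bool := [seq x < 0 | x <- d & x != 0].

Lemma signs_cat d1 d2 : signs (d1 ++ d2) = signs d1 ++ signs d2.
Proof. by rewrite /signs filter_cat map_cat. Qed.

Lemma signs_cons x d :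
  signs (x :: d) = if x == 0 then signs d else (x < 0) :: signs d.
Proof. by rewrite /signs /=; case: eqP. Qed.

Lemma var_cons x d : x != 0 -> var (x :: d) = flips (x < 0) (signs d).
Proof.
rewrite /var /= => /[dup] + ->; elim: d x => //= y d IHd x x0.
rewrite signs_cons; case: eqVneq => [_|y0] /=; first exact: IHd.
by rewrite flips_cons IHd // -!neqr0_sign // (inj_eq signr_inj) negb_eqb.
Qed.

Lemma cvarE d : cvar d = cyclic_flips (signs d).
Proof.
rewrite /cvar; elim: d => // x d IHd; rewrite signs_cons [find _ _]/=.
case: eqVneq => [_|x0]; first exact: IHd.
rewrite drop0 rcons_cons var_cons // cyclic_flips_cons.
by rewrite -!cats1 signs_cat signs_cons (negPf x0).
Qed.

Lemma odd_cvar d : odd (cvar d) = false.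
Proof. by rewrite cvarE odd_cyclic_flips. Qed.

Lemma cvar_eq0 d : cvar d = 0%N ->
  exists2 c, c != 0 & all (fun x => 0 <= c * x) d.
Proof.
rewrite cvarE => /cyclic_flips_eq0[b]; rewrite all_map all_filter => all_b.
exists ((-1) ^+ b); first by rewrite signr_eq0.
apply: sub_all all_b => x /=.
have [->|x0] := eqVneq x 0; first by rewrite mulr0.
move=> /= /eqP <-; rewrite mulr_sign; case: ltP => // /ltW.
by rewrite oppr_ge0.
Qed.

Lemma leq_cvar_size d : (cvar d <= size d)%N.
Proof.
rewrite cvarE (leq_trans (count_size _ _)) // size_cyclic_pairmap size_map.
by rewrite size_filter count_size.
Qed.

Lemma cvar_alternating d : cycle (fun x y => x * y < 0) d -> cvar d = size d.
Proof.
move=> alt_d; have d_neq0 : all (fun x => x != 0) d.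
  apply/allP=> x /(next_cycle alt_d); apply: contraTneq => ->.
  by rewrite mul0r ltxx.
rewrite cvarE /signs (all_filterP d_neq0) /cyclic_flips cyclic_pairmap_map.
rewrite -[RHS](size_cyclic_pairmap (fun x y => (x < 0) (+) (y < 0))).
apply/eqP; rewrite -all_count all_cyclic_pairmap.
by apply: sub_cycle alt_d => x y; rewrite mulr_lt0 => /and3P[].
Qed.

Lemma cvar_catC d1 d2 : cvar (d1 ++ d2) = cvar (d2 ++ d1).
Proof. by rewrite !cvarE !signs_cat cyclic_flips_catC. Qed.

Lemma cvar_rot n d : cvar (rot n d) = cvar d.
Proof. by rewrite cvar_catC cat_take_drop. Qed.

(* The hypothesis says that [z] vanishes or has the sign of [x] or of [y]. *)
Lemma leq_cvar_merge d1 x y z d2 :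
    (forall c, 0 <= c * x -> 0 <= c * y -> 0 <= c * z) ->
  (cvar (d1 ++ z :: d2) <= cvar (d1 ++ x :: y :: d2))%N.
Proof.
move=> z_sign; rewrite !cvarE leq_cyclic_flips_subseq //.
rewrite -[x :: _]/([:: x; y] ++ d2) -(cat1s z) !signs_cat.
rewrite subseq_cat2l subseq_cat2r.
have [->|z_neq0] := eqVneq z 0; first by rewrite signs_cons eqxx sub0seq.
rewrite signs_cons (negPf z_neq0) sub1seq !signs_cons.
have := z_sign (-1); have {z_sign} := z_sign 1.
rewrite !mul1r !mulN1r !oppr_ge0; move: z_neq0; case: (ltgtP z 0) => // _ _.
  by case: (ltgtP x 0) => // _; case: (ltgtP y 0) => // _ /(_ isT isT).
by case: (ltgtP x 0) => // _; case: (ltgtP y 0) => // _ _ /(_ isT isT).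
Qed.

Lemma leq_cvar_split d1 x a b d2 : 0 <= a -> 0 <= b ->
  (cvar (d1 ++ (a * x)%R :: (b * x)%R :: d2) <= cvar (d1 ++ x :: d2))%N.
Proof.
move=> a_ge0 b_ge0; have [->|x0] := eqVneq x 0.
  by rewrite !mulr0 !cvarE !signs_cat !signs_cons eqxx.
have signs_scale c : 0 <= c -> subseq (signs [:: c * x]) [:: x < 0].
  rewrite le_eqVlt => /predU1P[<-|c_gt0].
    by rewrite mul0r signs_cons eqxx.
  by rewrite signs_cons mulf_eq0 gt_eqF // (negPf x0) pmulr_rlt0.
rewrite !cvarE (signs_cat d1 (x :: d2)) signs_cons (negPf x0) -cyclic_flips_dup.
rewrite -(cat1s (a * x)) -(cat1s (b * x)) !signs_cat leq_cyclic_flips_subseq //.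
rewrite subseq_cat2l -[X in subseq _ X]/([:: x < 0] ++ [:: x < 0] ++ signs d2).
by rewrite !cat_subseq ?signs_scale.
Qed.

End CyclicSignVariation.

Lemma det_mx22 (R : comNzRingType) (A : 'M[R]_2) :
  \det A = A 0 0 * A 1 1 - A 0 1 * A 1 0.
Proof.
have lift0 : lift 0 0 = 1 :> 'I_2 by apply/val_inj.
have lift1 : lift 1 0 = 0 :> 'I_2 by apply/val_inj.
rewrite (expand_det_row _ 0) big_ord_recl big_ord1 /cofactor !det_mx11 !mxE.
by rewrite !lift0 lift1 /= expr0 expr1; ring.
Qed.

Lemma cV2P (T : Type) (u v : 'cV[T]_2) :
  u 0 0 = v 0 0 -> u 1 0 = v 1 0 -> u = v.
Proof.
move=> eq_uv0 eq_uv1; apply/colP=> i.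
have [->|->] // : i = 0 \/ i = 1.
by case: i => [[|[|//]] lt_i]; [left|right]; apply/val_inj.
Qed.

Section Wedge.
Variable R : comNzRingType.
Implicit Types (a b : R) (u v w : 'cV[R]_2).

Definition wedge u v : R := u 0 0 * v 1 0 - u 1 0 * v 0 0.

Definition coord_sum u : R := u 0 0 + u 1 0.

Lemma wedgeC u v : wedge v u = - wedge u v.
Proof. by rewrite /wedge; ring. Qed.

Lemma wedge_combr u v a b : wedge u (a *: u + b *: v) = b * wedge u v.
Proof. by rewrite /wedge !mxE; ring. Qed.

Lemma wedge_combl u v a b : wedge (a *: u + b *: v) v = a * wedge u v.
Proof. by rewrite /wedge !mxE; ring. Qed.

Lemma det_row_mx_wedge u v : \det (row_mx u v : 'M_2) = wedge u v.
Proof.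
have row_mx0 i : row_mx u v i 0 = u i 0.
  by rewrite -(row_mxEl u v); congr (row_mx _ _ _ _); apply/val_inj.
have row_mx1 i : row_mx u v i 1 = v i 0.
  by rewrite -(row_mxEr u v); congr (row_mx _ _ _ _); apply/val_inj.
by rewrite det_mx22 !row_mx0 !row_mx1 /wedge; ring.
Qed.

Lemma wedge_plucker u v w :
  coord_sum v * wedge u w = coord_sum w * wedge u v + coord_sum u * wedge v w.
Proof. by rewrite /coord_sum /wedge; ring. Qed.

Lemma wedge_cramer u v w : wedge u v *: w = wedge w v *: u + wedge u w *: v.
Proof. by apply: cV2P; rewrite /wedge !mxE; ring. Qed.

Lemma wedge_eq0_scale u v :
  wedge u v = 0 -> coord_sum u *: v = coord_sum v *: u.
Proof.
rewrite /coord_sum => /subr0_eq uv0.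
by apply: cV2P; rewrite !mxE; ring: uv0.
Qed.

Lemma coord_sumD u v : coord_sum (u + v) = coord_sum u + coord_sum v.
Proof. by rewrite /coord_sum !mxE; ring. Qed.

End Wedge.

Arguments wedge {R} u v.

Section NonnegativeVectors.
Variable R : realDomainType.
Implicit Types (a b : R) (u v w : 'cV[R]_2).

Definition nonneg u := (0 <= u 0 0) && (0 <= u 1 0).

Definition nonneg_neq0 u := nonneg u && (u != 0).

Definition in_cone u v w :=
  exists a b, [/\ 0 <= a, 0 <= b & w = a *: u + b *: v].

Lemma coord_sum_ge0 u : nonneg u -> 0 <= coord_sum u.
Proof. by case/andP=> u0 u1; rewrite addr_ge0. Qed.

Lemma nonnegD u v : nonneg u -> nonneg v -> nonneg (u + v).
Proof.
by move=> /andP[u0 u1] /andP[v0 v1]; rewrite /nonneg !mxE !addr_ge0.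
Qed.

Lemma nonnegZ a u : 0 <= a -> nonneg u -> nonneg (a *: u).
Proof. by move=> a0 /andP[u0 u1]; rewrite /nonneg !mxE !mulr_ge0. Qed.

Lemma nonneg_neq0P u :
  reflect (nonneg u /\ 0 < coord_sum u) (nonneg_neq0 u).
Proof.
apply: (iffP andP) => -[nn_u u_pos]; split=> //; last first.
  by apply: contraTneq u_pos => ->; rewrite /coord_sum !mxE addr0 ltxx.
have /andP[u0_ge0 u1_ge0] := nn_u; rewrite lt_def coord_sum_ge0 // andbT.
apply: contraNneq u_pos => /eqP; rewrite paddr_eq0 // => /andP[/eqP u0 /eqP u1].
by apply/eqP/cV2P; rewrite mxE.
Qed.

Lemma nonneg_neq0D u v : nonneg_neq0 u -> nonneg_neq0 v -> nonneg_neq0 (u + v).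
Proof.
move=> /nonneg_neq0P[nn_u u_gt0] /nonneg_neq0P[nn_v v_gt0].
by apply/nonneg_neq0P; rewrite nonnegD // coord_sumD addr_gt0.
Qed.

Lemma nonneg_neq0_delta i : nonneg_neq0 (delta_mx i 0).
Proof.
rewrite /nonneg_neq0 /nonneg !mxE !ler0n /=.
by apply/eqP=> /colP/(_ i)/eqP; rewrite !mxE !eqxx oner_eq0.
Qed.

Lemma in_cone_basis u : nonneg u -> in_cone (delta_mx 0 0) (delta_mx 1 0) u.
Proof.
move=> /andP[u0 u1]; exists (u 0 0), (u 1 0); split=> //.
by apply: cV2P; rewrite !mxE /=; ring.
Qed.

Lemma wedge_trans (c : R) :
  {in nonneg_neq0 & &, transitive (fun u v => 0 <= c * wedge u v)}.
Proof.
move=> v u w /nonneg_neq0P[_ v_gt0] /andP[nn_u _] /andP[nn_w _] uv vw.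
rewrite -(pmulr_rge0 _ v_gt0) mulrCA wedge_plucker.
by rewrite mulrDr !(mulrCA c) addr_ge0 // mulr_ge0 ?coord_sum_ge0.
Qed.

Lemma wedge_between_ge0 u v w : nonneg u -> nonneg v -> nonneg_neq0 w ->
    0 <= wedge u w * wedge w v ->
  0 <= wedge u v * wedge u w /\ 0 <= wedge u v * wedge w v.
Proof.
move=> /coord_sum_ge0 u_ge0 /coord_sum_ge0 v_ge0 /nonneg_neq0P[_ w_gt0] uwv_ge0.
split; rewrite -(pmulr_rge0 _ w_gt0) mulrA wedge_plucker mulrDl -!mulrA.
  by rewrite addr_ge0 // mulr_ge0 // 1?mulrC // -expr2 sqr_ge0.
by rewrite addr_ge0 // mulr_ge0 // -expr2 sqr_ge0.
Qed.

Lemma wedge_between_eq0 u v w : nonneg u -> nonneg_neq0 v ->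
  0 <= wedge u w * wedge w v -> wedge u v = 0 -> wedge u w = 0.
Proof.
move=> /coord_sum_ge0 u_ge0 /nonneg_neq0P[_ v_gt0] uwv_ge0 uv0.
have plucker0 : coord_sum v * wedge u w = - (coord_sum u * wedge w v).
  by apply/eqP; rewrite -addr_eq0 -wedge_plucker uv0 mulr0.
apply/eqP; rewrite -sqrf_eq0 eq_le sqr_ge0 andbT -(pmulr_rle0 _ v_gt0).
by rewrite expr2 mulrA plucker0 mulNr oppr_le0 -mulrA mulr_ge0 // mulrC.
Qed.

End NonnegativeVectors.

Arguments nonneg {R} u.
Arguments nonneg_neq0 {R} u.

Section ColumnVariation.
Variable R : realDomainType.
Implicit Types (a : R) (u v w : 'cV[R]_2) (s t : seq 'cV[R]_2).

Definition cvar_cols s : nat := cvar (cyclic_pairmap wedge s).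

Lemma cvar_cols_catC s1 s2 : cvar_cols (s1 ++ s2) = cvar_cols (s2 ++ s1).
Proof. by rewrite /cvar_cols [in RHS]cyclic_pairmap_catC cvar_rot. Qed.

Lemma leq_cvar_cols_delete s1 u s2 : all nonneg_neq0 (s1 ++ u :: s2) ->
  (cvar_cols (s1 ++ s2) <= cvar_cols (s1 ++ u :: s2))%N.
Proof.
rewrite all_cat /= => /and3P[nn1 nn_u nn2].
have {nn1 nn2} : all nonneg_neq0 (s2 ++ s1) by rewrite all_cat nn2.
rewrite cvar_cols_catC -cat_rcons [in leqRHS]cvar_cols_catC -rcons_cat.
case: (s2 ++ s1) => // v s nn_s.
have /andP[nn_v _] := nn_s; have nn_last := allP nn_s _ (mem_last v s).
rewrite /cvar_cols /= -!cats1 -catA !pairmap_cat.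
by apply: leq_cvar_merge => c; apply: wedge_trans.
Qed.

Lemma leq_cvar_cols_insert s1 u v w s2 : in_cone u v w ->
  (cvar_cols (s1 ++ u :: w :: v :: s2) <= cvar_cols (s1 ++ u :: v :: s2))%N.
Proof.
move=> [a [b [a0 b0 ->]]]; rewrite cvar_cols_catC [in leqRHS]cvar_cols_catC.
rewrite /cvar_cols /= wedge_combr wedge_combl.
exact: (leq_cvar_split [::]).
Qed.

Lemma leq_cvar_cols_insert_scale s1 u a s2 : 0 <= a ->
  (cvar_cols (s1 ++ u :: (a *: u)%R :: s2) <= cvar_cols (s1 ++ u :: s2))%N.
Proof.
move=> a0; rewrite cvar_cols_catC [in leqRHS]cvar_cols_catC !cat_cons.
case: (s2 ++ s1) => [|v t].
  have u_au0 : wedge u (a *: u) = 0 by rewrite /wedge !mxE; ring.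
  by rewrite /cvar_cols !cvarE /= (wedgeC u) u_au0 oppr0 !signs_cons eqxx.
apply: (@leq_cvar_cols_insert [::]); exists a, 0.
by rewrite scale0r addr0.
Qed.

Lemma leq_cvar_cols_join s1 u v s2 : all nonneg_neq0 (s1 ++ u :: v :: s2) ->
  (cvar_cols (s1 ++ (u + v)%R :: s2) <= cvar_cols (s1 ++ u :: v :: s2))%N.
Proof.
rewrite all_cat /= => /and4P[nn1 nn_u nn_v nn2].
have uv_cone : in_cone u v (u + v) by exists 1, 1; rewrite !scale1r.
apply: leq_trans (leq_cvar_cols_insert s1 s2 uv_cone).
have nn_uv := nonneg_neq0D nn_u nn_v.
rewrite -cat_rcons; apply: leq_trans (leq_cvar_cols_delete (u := v) _) _.
  by rewrite all_cat all_rcons nn1 nn_uv /= nn_v.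
by rewrite cat_rcons leq_cvar_cols_delete // all_cat nn1 /= nn_u nn_uv nn_v.
Qed.

Lemma leq_cvar_cols_scale s1 u a s2 : 0 <= a ->
  all nonneg_neq0 (s1 ++ u :: s2) -> a *: u != 0 ->
  (cvar_cols (s1 ++ (a *: u)%R :: s2) <= cvar_cols (s1 ++ u :: s2))%N.
Proof.
move=> a0; rewrite all_cat /= => /and3P[nn1 nn_u nn2] au0.
apply: leq_trans (leq_cvar_cols_insert_scale s1 u s2 a0).
rewrite leq_cvar_cols_delete // all_cat nn1 /= nn_u nn2 andbT /nonneg_neq0 au0.
by case/andP: nn_u => /(nonnegZ a0) ->.
Qed.

Lemma cvar_cols_eq0 s : all nonneg_neq0 s -> cvar_cols s = 0%N ->
  {in s &, forall u v, wedge u v = 0}.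
Proof.
move=> nn_s /cvar_eq0[c c0]; rewrite all_cyclic_pairmap.
rewrite (cycle_all2rel_in (wedge_trans (c := c))) // => /allrelP c_ge0.
move=> u v u_s v_s.
apply/eqP; rewrite -(mulrI_eq0 _ (mulfI c0)) eq_le c_ge0 // andbT.
by rewrite -oppr_ge0 -mulrN -wedgeC c_ge0.
Qed.

Lemma exists_column_between s : (2 < size s)%N -> (cvar_cols s < size s)%N ->
  exists n u w v t, rot n s = [:: u, w, v & t] /\ 0 <= wedge u w * wedge w v.
Proof.
move=> s_gt2 cvar_lt; set d := cyclic_pairmap wedge s.
pose neg (x y : R) := x * y < 0.
have : ~~ all id (cyclic_pairmap neg d).
  rewrite all_cyclic_pairmap; apply: contraTN cvar_lt => /cvar_alternating.
  by rewrite -leqNgt /cvar_cols -/d => ->; rewrite size_cyclic_pairmap.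
rewrite -has_predC => /hasP[b b_in /negPf b0]; rewrite {}b0 in b_in.
have := rot_index b_in; set n := index _ _.
rewrite -!cyclic_pairmap_rot; move: s_gt2; rewrite -(size_rot n).
case eq_rot : (rot n s) => [|u [|w [|v t]]] //= _ [neg_uwv].
by exists n, u, w, v, t; rewrite leNgt -[_ < 0]/(neg _ _) neg_uwv.
Qed.

Definition nonzero s := [seq u <- s | u != 0].

Lemma all_nonneg_neq0_nonzero s : all nonneg s -> all nonneg_neq0 (nonzero s).
Proof.
move=> nn_s; rewrite all_filter; apply: sub_all nn_s => u nn_u.
by apply/implyP; rewrite /nonneg_neq0 nn_u.
Qed.

Lemma column_op_nonneg s t : column_op s t -> all nonneg s -> all nonneg t.
Proof.
case=> [s1 u v s2|s1 u s2|s' u|s1 u s2 a a0]; rewrite ?all_cat /=.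
- by case/and4P=> -> nn_u nn_v ->; rewrite nonnegD.
- by case/and3P=> -> -> ->.
- by rewrite all_rcons.
by case/and3P=> -> nn_u ->; rewrite nonnegZ.
Qed.

Lemma leq_column_op_cvar_cols s t : column_op s t -> all nonneg s ->
  (cvar_cols (nonzero t) <= cvar_cols (nonzero s))%N.
Proof.
move=> op /all_nonneg_neq0_nonzero; rewrite /nonzero.
case: op => [s1 u v s2|s1 u s2|s' u|s1 u s2 a a0]; rewrite ?filter_cat /=.
- have [->|u0] := eqVneq u 0; first by rewrite add0r.
  have [->|v0] := eqVneq v 0; first by rewrite addr0 u0.
  rewrite /= => nn; have: nonneg_neq0 (u + v).
    move: nn; rewrite all_cat /= => /and4P[_ nn_u nn_v _].
    exact: nonneg_neq0D.
  by case/andP=> _ ->; exact: leq_cvar_cols_join.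
- case: eqVneq => //= u0 _; rewrite -{2}[u]scale1r.
  exact: leq_cvar_cols_insert_scale ler01.
- by rewrite filter_rcons; case: ifP => _ _ //; rewrite -cats1 cvar_cols_catC.
have [->|u0] := eqVneq u 0; first by rewrite scaler0 eqxx.
have [_|au0] /= := eqVneq (a *: u) 0 => nn; first exact: leq_cvar_cols_delete.
exact: leq_cvar_cols_scale.
Qed.

Lemma cvar_mxE n (M : 'M[R]_(2, n)) : cvar_mx M = cvar_cols (columns M).
Proof.
rewrite /cvar_cols cyclic_pairmap_enum_ord; congr cvar.
by apply: eq_map => i; rewrite /Delta det_row_mx_wedge.
Qed.

End ColumnVariation.

Section Reachability.
Variable R : realDomainType.
Implicit Types (u v w : 'cV[R]_2) (s t : seq 'cV[R]_2).

Lemma columns_1 : columns (1%:M : 'M[R]_2) = [:: delta_mx 0 0; delta_mx 1 0].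
Proof.
rewrite /columns enum_ordSl enum_ordSl enum_ord0 /= !col1.
by congr [:: _; delta_mx _ 0]; apply/val_inj.
Qed.

Definition reach : seq 'cV[R]_2 -> seq 'cV[R]_2 -> Prop :=
  clos_refl_trans _ (@column_op R).

Lemma reach_step s t : column_op s t -> reach s t.
Proof. exact: rt_step. Qed.

Lemma reach_trans s1 s2 s3 : reach s1 s2 -> reach s2 s3 -> reach s1 s3.
Proof. exact: rt_trans. Qed.

Lemma reach_catC s1 s2 : reach (s1 ++ s2) (s2 ++ s1).
Proof.
elim/last_ind: s2 s1 => [|s2 u IHs] s1; first by rewrite cats0; exact: rt_refl.
rewrite -rcons_cat cat_rcons.
exact: reach_trans (reach_step (CyclicShift _ u)) (IHs (u :: s1)).
Qed.

Lemma reach_insert s1 u v w s2 : in_cone u v w ->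
  reach (s1 ++ u :: v :: s2) (s1 ++ u :: w :: v :: s2).
Proof.
move=> [a [b [a0 b0 ->]]].
apply: reach_trans (reach_step (Double s1 u (v :: s2))) _.
rewrite -!(cat_rcons u s1).
apply: reach_trans (reach_step (Rescale (rcons s1 u) u (v :: s2) a0)) _.
rewrite -(cat_rcons (a *: u)).
apply: reach_trans (reach_step (Double _ v s2)) _.
apply: reach_trans (reach_step (Rescale _ v (v :: s2) b0)) _.
by rewrite (cat_rcons (a *: u)); exact: reach_step (Join _ _ _ _).
Qed.

Lemma reach_delete s1 u s2 : s1 ++ s2 != [::] ->
  reach (s1 ++ u :: s2) (s1 ++ s2).
Proof.
move=> s_neq0; apply: reach_trans (reach_step (Rescale s1 u s2 (lexx 0))) _.
rewrite scale0r; case: s2 s_neq0 => [|v s2] s_neq0.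
  case/lastP: s1 s_neq0 => // s1 v _; rewrite cats0 cat_rcons -cats1.
  by have := Join s1 v 0 [::]; rewrite addr0; exact: reach_step.
by have := Join s1 0 v s2; rewrite add0r; exact: reach_step.
Qed.

Lemma leq_reach_cvar_cols s t : reach s t ->
  all nonneg_neq0 s -> all nonneg_neq0 t -> (cvar_cols t <= cvar_cols s)%N.
Proof.
have nonneg_neq0E r : all nonneg_neq0 r -> all nonneg r /\ nonzero r = r.
  rewrite all_predI => /andP[nn_r nz_r]; split=> //; exact/all_filterP.
move=> st /nonneg_neq0E[nn_s nz_s] /nonneg_neq0E[_ nz_t].
rewrite -{1}nz_t -{1}nz_s {nz_s nz_t}.
suff [] : all nonneg t /\
    (cvar_cols (nonzero t) <= cvar_cols (nonzero s))%N by [].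
elim: st nn_s => {s t} [s t op|s|r s t _ IHrs _ IHst] nn_s //.
  by split; [exact: column_op_nonneg op _|exact: leq_column_op_cvar_cols].
have [/IHst[nn_t le_ts] le_sr] := IHrs nn_s.
by split=> //; exact: leq_trans le_sr.
Qed.

End Reachability.

Section Construction.
Variable R : realFieldType.
Implicit Types (u v w : 'cV[R]_2) (s : seq 'cV[R]_2).

Local Notation e1 := (delta_mx 0 0 : 'cV[R]_2).
Local Notation e2 := (delta_mx 1 0 : 'cV[R]_2).

Lemma in_cone_between u v w :
    nonneg_neq0 u -> nonneg_neq0 v -> nonneg_neq0 w ->
  0 <= wedge u w * wedge w v -> in_cone u v w.
Proof.
move=> nn_u nn_v nn_w uwv_ge0.
have /nonneg_neq0P[nonneg_u u_gt0] := nn_u; have /andP[nonneg_v _] := nn_v.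
have [uv0|uv_neq0] := eqVneq (wedge u v) 0.
  have uw0 := wedge_between_eq0 nonneg_u nn_v uwv_ge0 uv0.
  exists (coord_sum w / coord_sum u), 0; split=> //.
    by rewrite divr_ge0 ?coord_sum_ge0 //; case/andP: nn_w.
  rewrite scale0r addr0 mulrC -scalerA -wedge_eq0_scale //.
  by rewrite scalerK // gt_eqF.
have div_ge0 x : 0 <= wedge u v * x -> 0 <= x / wedge u v.
  have -> : x / wedge u v = wedge u v * x / wedge u v ^+ 2 by field.
  by move=> uvnonneg_x; rewrite divr_ge0 ?sqr_ge0.
have [uvuw_ge0 uvwv_ge0] := wedge_between_ge0 nonneg_u nonneg_v nn_w uwv_ge0.
exists (wedge w v / wedge u v), (wedge u w / wedge u v).
split; [exact: div_ge0|exact: div_ge0|].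
by rewrite ![_ / _]mulrC -!scalerA -scalerDr -wedge_cramer scalerK.
Qed.

Lemma reach_pair u v : nonneg_neq0 u -> nonneg_neq0 v ->
  reach [:: e1; e2] [:: u; v].
Proof.
have reach_ccw x y : nonneg_neq0 x -> nonneg_neq0 y -> 0 <= wedge x y ->
    reach [:: e1; e2] [:: x; y].
  move=> nn_x nn_y xy_ge0; have /andP[nonneg_x _] := nn_x.
  have y_cone : in_cone x e2 y.
    apply: in_cone_between => //; first exact: nonneg_neq0_delta.
    apply: mulr_ge0 => //; rewrite /wedge !mxE /= mulr1 mulr0 subr0.
    by case/andP: nn_y => /andP[].
  apply: reach_trans (reach_insert [::] [::] (in_cone_basis nonneg_x)) _.
  apply: reach_trans (reach_insert [:: e1] [::] y_cone) _.
  apply: reach_trans (@reach_delete _ [::] _ _ _) _ => //.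
  exact: (@reach_delete _ [:: x; y]).
move=> nn_u nn_v; have [|/ltW] := leP 0 (wedge u v); first exact: reach_ccw.
move=> uv_le0; apply: reach_trans (reach_catC [:: v] [:: u]).
by apply: reach_ccw; rewrite // wedgeC oppr_ge0.
Qed.

Lemma reach_basis_cvar_le2 s : s != [::] -> all nonneg_neq0 s ->
  (cvar_cols s <= 2)%N -> reach [:: e1; e2] s.
Proof.
have [m] := ubnP (size s); elim: m => // m IHm in s *.
case: s => [|u [|v [|w t]]] //.
- move=> _ _ /= /andP[nn_u _] _; apply: reach_trans (reach_pair nn_u nn_u) _.
  exact: (@reach_delete _ [::]).
- by move=> _ _ /= /and3P[nn_u nn_v _] _; exact: reach_pair.
set s := u :: _ => lt_m _ nn_s cvar_s.
have [//||n [x [z [y [r [rot_s xzy_ge0]]]]]] := exists_column_between (s := s).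
  exact: leq_ltn_trans cvar_s _.
have : all nonneg_neq0 [:: x, z, y & r].
  by rewrite -rot_s (eq_all_r (mem_rot n s)).
move=> /[dup] nn_r /and4P[nn_x nn_z nn_y nn_r'].
have cone_z := in_cone_between nn_x nn_y nn_z xzy_ge0.
apply: (reach_trans (s2 := [:: x, z, y & r])); last first.
  rewrite -rot_s -{2}(cat_take_drop n s); exact: reach_catC.
apply: reach_trans (reach_insert [::] r cone_z).
apply: IHm => //.
- by move: lt_m; rewrite -(size_rot n) rot_s.
- by rewrite /= nn_x nn_y.
apply: leq_trans (@leq_cvar_cols_delete _ [:: x] z (y :: r) nn_r) _.
by rewrite cat1s -rot_s /cvar_cols cyclic_pairmap_rot cvar_rot.
Qed.

Lemma mxrank_le1_wedge n (M : 'M[R]_(2, n)) u : nonneg_neq0 u ->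
  (forall j, wedge u (col j M) = 0) -> (\rank M <= 1)%N.
Proof.
move=> /nonneg_neq0P[_ u_gt0] uM0.
have -> : M = u *m (\row_j (coord_sum (col j M) / coord_sum u)).
  apply/matrixP=> i j; rewrite mxE big_ord1 mxE mulrA [u i 0 * _]mulrC.
  have /colP/(_ i) := wedge_eq0_scale (uM0 j).
  rewrite mxE [in RHS]mxE [col j M i 0]mxE => <-.
  by rewrite mulrC mulKf // gt_eqF.
exact: mulmx_max_rank.
Qed.

Lemma cvar_mx_neq0 n (M : 'M[R]_(2, n)) :
  all nonneg_neq0 (columns M) -> (1 < \rank M)%N -> cvar_mx M != 0%N.
Proof.
rewrite cvar_mxE => nn_M; apply: contraTneq => /(cvar_cols_eq0 nn_M) wedge0.
rewrite -leqNgt; have col_in j : col j M \in columns M.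
  by apply: map_f; rewrite mem_enum.
case: n M nn_M wedge0 col_in => [|n] M nn_M wedge0 col_in.
  exact: leq_trans (rank_leq_col M) _.
apply: (@mxrank_le1_wedge _ _ (col 0 M)); first exact: allP nn_M _ (col_in _).
by move=> j; apply: wedge0.
Qed.

End Construction.

Theorem theorem4p9 (R : realType) (n : nat) (M : 'M[R]_(2, n))
    (M_ge0 : forall i j, 0 <= M i j)
    (M_rank : \rank M = 2%N)
    (M_col_neq0 : forall j, col j M != 0) :
  cvar_mx M = 2%N <-> constructible_from (1%:M : 'M[R]_2) M.
Proof.
have nn_M : all nonneg_neq0 (columns M).
  apply/allP=> _ /mapP[j _ ->].
  by rewrite /nonneg_neq0 M_col_neq0 /nonneg !mxE !M_ge0.
have cvar_neq0 : cvar_mx M != 0%N by rewrite cvar_mx_neq0 ?M_rank.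
have even_cvar : odd (cvar_mx M) = false by rewrite odd_cvar.
rewrite /constructible_from columns_1; split=> [cvar2|reach_M].
  apply: reach_basis_cvar_le2; rewrite -?cvar_mxE ?cvar2 //.
  by apply: contra_neq cvar_neq0; rewrite cvar_mxE => ->.
have le_cvar2 : (cvar_mx M <= 2)%N.
  have nn_basis : all nonneg_neq0 [:: delta_mx 0 0; delta_mx 1 0 : 'cV[R]_2].
    by rewrite /= !nonneg_neq0_delta.
  rewrite cvar_mxE; apply: leq_trans (leq_reach_cvar_cols reach_M _ _) _ => //.
  exact: leq_cvar_size.
by case: (cvar_mx M) cvar_neq0 even_cvar le_cvar2 => [|[|[|]]].
Qed.
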